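(* Let $\mathbf{D}$ be any category. The interleaving distance $d$ is an extended pseudometric on any subset of the class of $(\mathbb{R},\leq)$-indexed diagrams in $\mathbf{D}$; that is, for all diagrams $F,G,H$ in such a subset, $d(F,G)\in[0,\infty]$, $d(F,F)=0$, $d(F,G)=d(G,F)$ and $d(F,H)\leq d(F,G)+d(G,H)$.
   Context: $(\mathbb{R},\leq)$ denotes the poset of real numbers viewed as a category. An $(\mathbb{R},\leq)$-indexed diagram in $\mathbf{D}$ is a functor $F:(\mathbb{R},\leq)\to\mathbf{D}$. For $b\geq 0$, $T_b:(\mathbb{R},\leq)\to(\mathbb{R},\leq)$ is the functor $T_b(a)=a+b$, and $\eta_b:\mathrm{Id}\Rightarrow T_b$ is the natural transformation with components $a\leq a+b$. For $\varepsilon\geq 0$, an $\varepsilon$-interleaving of $F$ and $G$ consists of natural transformations $\varphi:F\Rightarrow GT_\varepsilon$ and $\psi:G\Rightarrow FT_\varepsilon$ such that $(\psi T_\varepsilon)\varphi=F\eta_{2\varepsilon}$ and $(\varphi T_\varepsilon)\psi=G\eta_{2\varepsilon}$, i.e. for all $a\in\mathbb{R}$, $\psi(a+\varepsilon)\varphi(a)=F(a\leq a+2\varepsilon)$ and $\varphi(a+\varepsilon)\psi(a)=G(a\leq a+2\varepsilon)$. If one exists, $F$ and $G$ are called $\varepsilon$-interleaved. The interleaving distance is $d(F,G)=\inf\{\varepsilon\geq 0 \mid F \text{ and } G \text{ are } \varepsilon\text{-interleaved}\}$, with $d(F,G)=\infty$ if $F$ and $G$ are not $\varepsilon$-interleaved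 for any $\varepsilon\geq 0$. *)

(* Defs.v *)
From mathcomp Require Import all_boot all_order all_algebra.
From mathcomp Require Import boolp classical_sets reals interval_inference.
From mathcomp Require Import constructive_ereal ereal.

Set Implicit Arguments.
Unset Strict Implicit.
Unset Printing Implicit Defensive.
Import Order.TTheory GRing.Theory Num.Theory.
Local Open Scope classical_set_scope.
Local Open Scope ring_scope.

Record category := Category {
  obj :> Type;
  hom : obj -> obj -> Type;
  idm : forall a, hom a a;
  compm : forall a b c, hom b c -> hom a b -> hom a c;
  compm1 : forall a b (f : hom a b), compm f (idm a) = f;
  comp1m : forall a b (f : hom a b), compm (idm b) f = f;
  compmA : forall a b c d (h : hom c d) (g : hom b c) (f : hom a b),
    compm h (compm g f) = compm (compm h g) f }.

Arguments idm [c] a : rename.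
Arguments compm [c a b _] g f : rename.

Record functor (C D : category) := Functor {
  fobj :> C -> D;
  fmap : forall a b : C, hom a b -> hom (fobj a) (fobj b);
  fmap1 : forall a : C, fmap (idm a) = idm (fobj a);
  fmapM : forall (a b c : C) (g : hom b c) (f : hom a b),
    fmap (compm g f) = compm (fmap g) (fmap f) }.

Arguments fmap [C D] F [a b] f : rename.

Record nat_trans (C D : category) (F G : functor C D) := NatTrans {
  component :> forall a : C, hom (F a) (G a);
  naturality : forall (a b : C) (f : hom a b),
    compm (component b) (fmap F f) = compm (fmap G f) (component a) }.

Section FunctorComposition.
Variables (B C D : category) (G : functor C D) (F : functor B C).

Fact comp_fmap1 (a : B) : fmap G (fmap F (idm a)) = idm (G (F a)).
Proof. by rewrite !fmap1. Qed.

Fact comp_fmapM (a b c : B) (g : hom b c) (f : hom a b) :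
  fmap G (fmap F (compm g f)) =
  compm (fmap G (fmap F g)) (fmap G (fmap F f)).
Proof. by rewrite !fmapM. Qed.

Definition functor_comp : functor B D :=
  @Functor B D (fun a => G (F a)) (fun a b f => fmap G (fmap F f))
    comp_fmap1 comp_fmapM.

End FunctorComposition.

Section Interleaving.
Variable R : realType.

(* Since [a <= b] is a boolean, it has at most one proof: each hom-type of
   this category has at most one element. *)
Definition real_category : category :=
  @Category R (fun a b => a <= b) (@lexx _ R)
    (fun a b c bc ab => le_trans ab bc)
    (fun a b f => bool_irrelevance _ f)
    (fun a b f => bool_irrelevance _ f)
    (fun a b c d h g f => bool_irrelevance _ _).

Definition diagram (D : category) := functor real_category D.

Definition shift (e : {nonneg R}) : functor real_category real_category :=
  @Functor real_category real_category (fun a => a + e%:num)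
    (fun a b (ab : a <= b) => lerD ab (lexx e%:num))
    (fun a => bool_irrelevance _ _)
    (fun a b c g f => bool_irrelevance _ _).

(* The functors T_e T_e and T_(2e) are identified: the morphism a <= a + 2e is
   written with target a + e + e, the object on which the composites
   psi (a + e) (phi a) and phi (a + e) (psi a) land. *)
Fact le_shift2 (e : {nonneg R}) (a : R) : a <= a + e%:num + e%:num.
Proof. by rewrite -addrA lerDl addr_ge0. Qed.

Section Diagrams.
Variable D : category.
Implicit Types F G : diagram D.

Definition is_interleaving (e : {nonneg R}) F G
    (phi : nat_trans F (functor_comp G (shift e)))
    (psi : nat_trans G (functor_comp F (shift e))) : Prop :=
  forall a : R,
    compm (psi (a + e%:num)) (phi a) =
      @fmap real_category D F a (a + e%:num + e%:num) (le_shift2 e a) /\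
    compm (phi (a + e%:num)) (psi a) =
      @fmap real_category D G a (a + e%:num + e%:num) (le_shift2 e a).

Definition interleaved (e : {nonneg R}) F G : Prop :=
  exists phi psi, @is_interleaving e F G phi psi.

(* The infimum of the empty set is +oo. *)
Definition interleaving_distance F G : \bar R :=
  ereal_inf [set (e%:num)%:E | e in [set e : {nonneg R} | interleaved e F G]].

End Diagrams.

(* [\bar R] contains -oo, hence the explicit nonnegativity. *)
Definition extended_pseudometric_on (T : Type) (S : set T)
    (d : T -> T -> \bar R) : Prop :=
  [/\ forall x y, S x -> S y -> (0 <= d x y)%E,
      forall x, S x -> d x x = 0%E,
      forall x y, S x -> S y -> d x y = d y x &
      forall x y z, S x -> S y -> S z -> (d x z <= d x y + d y z)%E].

End Interleaving.

(* Main.v *)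
Require Import Defs.
From mathcomp Require Import all_boot all_order all_algebra.
From mathcomp Require Import boolp classical_sets reals interval_inference.
From mathcomp Require Import constructive_ereal ereal.

(** The three axioms reflect three facts about interleavings.
    - The structure map [F(a <= a + e)] interleaves [F] with itself for every
      [e], in particular for [e = 0], so [d F F = 0].
    - Exchanging the two natural transformations of an interleaving of [F] and
      [G] gives an interleaving of [G] and [F], so [d] is symmetric.
    - Interleavings compose and their parameters add up
      ([interleaved_trans]): going from [F] to [G] to [H] and back, the inner
      round trip [G -> H -> G] collapses to a structure map of [G]; naturality
      turns it into a structure map of [F], after which the outer round trip
      [F -> G -> F] collapses as well.  The triangle inequality follows by
      taking the infimum over the two parameters, one at a time.

    The objects [a + e1 + e2] and [a + (e1 + e2)] of the real line are equal but
    not convertible.  No morphism is transported along this equality: it is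
    weakened to an inequality, and the corresponding structure map is inserted.
    All structure maps between two given objects agree, so the insertions are
    absorbed by functoriality. *)

Set Implicit Arguments.
Unset Strict Implicit.
Unset Printing Implicit Defensive.
Import Order.TTheory GRing.Theory Num.Theory.
(* Restores [hom] to the morphisms of a category, instead of linear maps. *)
Import Defs.
Local Open Scope classical_set_scope.
Local Open Scope ring_scope.

Section InterleavingTheory.
Variables (R : realType) (D : category).
Implicit Types (F G H : diagram R D) (e : {nonneg R}) (a b c : R).

(** The structure map of a diagram at an inequality, stated on reals so that
    the inequality can be supplied by any proof. *)
Definition structure_map F a b (ab : a <= b) : hom (F a) (F b) :=
  @fmap (real_category R) D F a b ab.

(** The proof [ac] is arbitrary: this is how coherence between different
    bracketings of a sum of shifts is handled throughout. *)
Lemma structure_map_comp F a b c (ab : a <= b) (bc : b <= c) (ac : a <= c) :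
  compm (structure_map F bc) (structure_map F ab) = structure_map F ac.
Proof.
rewrite /structure_map -fmapM; congr (fmap F _); exact: bool_irrelevance.
Qed.

Lemma shift_naturality F G e (phi : nat_trans F (functor_comp G (shift e)))
    a b (ab : a <= b) (abe : a + e%:num <= b + e%:num) :
  compm (phi b) (structure_map F ab) = compm (structure_map G abe) (phi a).
Proof.
rewrite /structure_map naturality /=; congr (compm (fmap G _) _).
exact: bool_irrelevance.
Qed.

Fact le_shift e a : a <= a + e%:num.
Proof. by rewrite lerDl. Qed.

Fact unit_shift_natural F e (a b : real_category R) (f : hom a b) :
  compm (structure_map F (le_shift e b)) (fmap F f) =
  compm (fmap (functor_comp F (shift e)) f) (structure_map F (le_shift e a)).
Proof.
have abe : a <= b + e%:num by exact: le_trans f (le_shift e b).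
by rewrite (structure_map_comp _ f _ abe) /= (structure_map_comp _ _ _ abe).
Qed.

(** The natural transformation usually written [F eta_e]. *)
Definition unit_shift F e : nat_trans F (functor_comp F (shift e)) :=
  @NatTrans (real_category R) D F (functor_comp F (shift e))
    (fun a => structure_map F (le_shift e a)) (@unit_shift_natural F e).

Lemma interleaved_refl F e : interleaved e F F.
Proof.
exists (unit_shift F e), (unit_shift F e) => a.
by split; exact: structure_map_comp.
Qed.

Lemma interleaved_sym F G e : interleaved e F G -> interleaved e G F.
Proof.
move=> [phi [psi phi_psi]]; exists psi, phi => a.
by have [? ?] := phi_psi a; split.
Qed.

Section Composition.
Variables (e1 e2 e : {nonneg R}).
Hypothesis le_e : e1%:num + e2%:num <= e%:num.

Fact le_shiftD a : a + e1%:num + e2%:num <= a + e%:num.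
Proof. by rewrite -addrA lerD2l. Qed.

Variables F G H : diagram R D.
Variable phi : nat_trans F (functor_comp G (shift e1)).
Variable phi' : nat_trans G (functor_comp H (shift e2)).

Definition comp_shift_component a : hom (F a) (H (a + e%:num)) :=
  compm (structure_map H (le_shiftD a)) (compm (phi' (a + e1%:num)) (phi a)).

Fact comp_shift_natural (a b : real_category R) (f : hom a b) :
  compm (comp_shift_component b) (fmap F f) =
  compm (fmap (functor_comp H (shift e)) f) (comp_shift_component a).
Proof.
have ab1 : a + e1%:num <= b + e1%:num by rewrite lerD2r.
have ab12 : a + e1%:num + e2%:num <= b + e1%:num + e2%:num by rewrite lerD2r.
have abe : a + e1%:num + e2%:num <= b + e%:num.
  exact: le_trans ab12 (le_shiftD b).
rewrite /comp_shift_component -!compmA (shift_naturality phi f ab1).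
rewrite (compmA (phi' _)) (shift_naturality phi' ab1 ab12) !compmA.
rewrite (structure_map_comp _ _ _ abe).
by rewrite /= -/(structure_map H _) (structure_map_comp _ _ _ abe).
Qed.

(** The parameter [e] is only bounded below by [e1 + e2] so that the same
    construction serves in both directions: the return trip crosses the shifts
    in the opposite order and produces [e2 + e1]. *)
Definition comp_shift : nat_trans F (functor_comp H (shift e)) :=
  @NatTrans (real_category R) D F (functor_comp H (shift e))
    comp_shift_component comp_shift_natural.

End Composition.

(** One half of the composition of two interleavings: only the round trips
    based at [G] via [H] and at [F] via [G] are involved, so the other half is
    an instance with the two interleavings exchanged. *)
Lemma comp_shift_round_trip e1 e2 e (le12 : e1%:num + e2%:num <= e%:num)
    (le21 : e2%:num + e1%:num <= e%:num) F G H
    (phi : nat_trans F (functor_comp G (shift e1)))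
    (psi : nat_trans G (functor_comp F (shift e1)))
    (phi' : nat_trans G (functor_comp H (shift e2)))
    (psi' : nat_trans H (functor_comp G (shift e2))) a :
    (forall b, compm (psi (b + e1%:num)) (phi b) =
      structure_map F (le_shift2 e1 b)) ->
    (forall b, compm (psi' (b + e2%:num)) (phi' b) =
      structure_map G (le_shift2 e2 b)) ->
  compm (comp_shift le21 psi' psi (a + e%:num)) (comp_shift le12 phi phi' a) =
  structure_map F (le_shift2 e a).
Proof.
move=> FGF GHG; rewrite /= /comp_shift_component.
set b := a + e%:num.
have ab12 : a + e1%:num + e2%:num <= b := le_shiftD le12 a.
have ab122 : a + e1%:num + e2%:num + e2%:num <= b + e2%:num by rewrite lerD2r.
have ab1 : a + e1%:num <= b + e2%:num := le_trans (le_shift2 e2 _) ab122.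
have ab11 : a + e1%:num + e1%:num <= b + e2%:num + e1%:num by rewrite lerD2r.
have ab : a <= b + e2%:num + e1%:num := le_trans (le_shift2 e1 _) ab11.
rewrite -!compmA (compmA (psi' b)).
rewrite (shift_naturality psi' (le_shiftD le12 a) ab122).
rewrite -(compmA (structure_map G _)) (compmA (psi' _)) GHG.
rewrite (compmA (structure_map G _)) (structure_map_comp _ _ _ ab1).
rewrite (compmA (psi _)) (shift_naturality psi ab1 ab11).
rewrite -(compmA (structure_map F _)) FGF (structure_map_comp _ _ _ ab).
exact: structure_map_comp.
Qed.

Lemma interleaved_trans e1 e2 e F G H : e1%:num + e2%:num <= e%:num ->
  interleaved e1 F G -> interleaved e2 G H -> interleaved e F H.
Proof.
move=> le12 [phi [psi FG]] [phi' [psi' GH]].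
have le21 : e2%:num + e1%:num <= e%:num by rewrite addrC.
exists (comp_shift le12 phi phi'), (comp_shift le21 psi' psi) => a; split.
  by apply: comp_shift_round_trip => b; [case: (FG b)|case: (GH b)].
by apply: comp_shift_round_trip => b; [case: (GH b)|case: (FG b)].
Qed.

Local Notation d := (@interleaving_distance R D).

Lemma interleaving_distance_le e F G : interleaved e F G ->
  (d F G <= e%:num%:E)%E.
Proof. by move=> FG; apply: ereal_inf_lbound; exists e. Qed.

Lemma le_interleaving_distance F G (x : \bar R) :
  (forall e, interleaved e F G -> (x <= e%:num%:E)%E) -> (x <= d F G)%E.
Proof. by move=> xle; apply: le_ereal_inf_tmp => _ [e FG <-]; exact: xle. Qed.

Lemma interleaving_distance_ge0 F G : (0 <= d F G)%E.
Proof. by apply: le_interleaving_distance => e _; rewrite lee_fin. Qed.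

Lemma interleaving_distance_refl F : d F F = 0%E.
Proof.
apply/le_anti; rewrite interleaving_distance_ge0 andbT.
exact: interleaving_distance_le (interleaved_refl F 0%:nng).
Qed.

Lemma interleaving_distance_sym F G : d F G = d G F.
Proof.
by apply/le_anti/andP; split; apply: le_interleaving_distance => e /interleaved_sym;
  exact: interleaving_distance_le.
Qed.

Lemma interleaving_distance_triangle F G H : (d F H <= d F G + d G H)%E.
Proof.
have le_step e2 : interleaved e2 G H -> (d F H <= d F G + e2%:num%:E)%E.
  move=> GH; rewrite -leeBlDr//; apply: le_interleaving_distance => e1 FG.
  rewrite leeBlDr// -EFinD.
  apply: (@interleaving_distance_le (e1%:num + e2%:num)%:nng).
  by apply: interleaved_trans FG GH.
(* The bound by [d F G] can be subtracted only when it is finite. *)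
have [dFG_fin|] := boolP (d F G \is a fin_num); last first.
  rewrite ge0_fin_numE ?interleaving_distance_ge0// -leNgt leye_eq => /eqP ->.
  by rewrite addye ?leey// gt_eqF// (lt_le_trans _ (interleaving_distance_ge0 _ _)).
rewrite -leeBlDl//; apply: le_interleaving_distance => e2 GH.
by rewrite leeBlDl// le_step.
Qed.

End InterleavingTheory.

Theorem theorem3p3 (R : realType) (D : category) (S : set (diagram R D)) :
  extended_pseudometric_on S (@interleaving_distance R D).
Proof.
split=> *; first exact: interleaving_distance_ge0.
- exact: interleaving_distance_refl.
- exact: interleaving_distance_sym.
- exact: interleaving_distance_triangle.
Qed.
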